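(* Let $Y$ be a finite graph with an edge-free action of a finite group $G$, let $\mathbb{X}=Y/\!\!/G$ be the quotient graph of groups, and let $\rho_G$ be the right regular representation of $G$. Then $$\zeta(u,Y)=L(u,\rho_G,Y/\mathbb{X}).$$
   Context: Graphs. A graph (with legs) $X$ consists of vertices $V(X)$, half-edges $H(X)$, a root map $r:H(X)\to V(X)$, and an involution $h\mapsto\overline h$ on $H(X)$. Orbits $\{h,\overline h\}$ of size 2 are edges; half-edges with $\overline h=h$ are legs, forming the set $L(X)$. All graphs are connected. A path of length $n\ge1$ in $X$ is a sequence $h_1\cdots h_n$ of half-edges with $r(h_{j+1})=r(\overline{h_j})$ for $1\le j\le n-1$; it is closed if $r(\overline{h_n})=r(h_1)$; a closed path is reduced if $h_{j+1}\ne\overline{h_j}$ for all $j\in\{1,\dots,n\}$ (indices mod $n$). A closed reduced path is primitive if it is not a power $R^k$, $k\ge2$, of a path. Closed paths are equivalent if they differ by a cyclic shift. A prime $\mathfrak p$ is an equivalence class of primitive paths, with length $\ell(\mathfrak p)$ the common length of its representatives. The Ihara zeta function of a finite graph $Y$ is $\zeta(u,Y)=\prod_{\mathfrak p}(1-u^{\ell(\mathfrak p)})^{-1}$ over all primes of $Y$. Graphs of groups. An edge-trivial graph of groups $\mathbb{X}=(X,X_v)$ is a graph $X$ with a group $X_v$ for each $v\in V(X)$. A path of length $n\ge1$ in $\mathbb{X}$ is $g_0h_1g_1h_2\cdots g_{n-1}h_n$ where $h_1\cdots h_n$ is a path in $X$, $g_0\in X_{r(h_1)}$ and $g_j\in X_{r(\overline{h_j})}$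 for $1\le j\le n-1$. It is closed if $h_1\cdots h_n$ is closed; a closed path is reduced if for each $j\in\{1,\dots,n\}$ (indices mod $n$) either $h_{j+1}\ne\overline{h_j}$ or $g_j\ne1$. Primitive paths, equivalence (simultaneous cyclic shift of the $g_{j-1}$ and $h_j$), primes and lengths are defined as for graphs. Quotients. A $G$-action on $Y$ (by bijections of $V(Y)$ and $H(Y)$ commuting with $r$ and the involution) is edge-free if $G$ acts freely on $H(Y)$. The quotient graph $X=Y/G$ has $V(X)=V(Y)/G$, $H(X)=H(Y)/G$, with induced root map and involution; $\pi:Y\to X$ is the projection. Choose a spanning tree $T_X\subset X$ and a connected lift $T\subset Y$ of it; for $v\in V(X)$ let $v^T$ be its lift to $T$. The graph of groups $\mathbb{X}=Y/\!\!/G$ has underlying graph $X$ and $X_v=$ stabilizer of $v^T$ in $G$. For each $h\in H(X)$ choose $h^S\in H(Y)$ above $h$ and $F(h)\in G$ as follows. If $h\in H(T_X)$, $h^S$ is its lift to $T$ and $F(h)=1$. For each edge of $X$ not in $T_X$ choose an orientation $(h,\overline h)$ and let $v=r(\overline h)$; choose $h^S$ above $h$ rooted at $r(h)^T$, choose $F(h)\in G$ with $F(h)(v^T)=r(\overline{h^S})$, and set $F(\overline h)=F(h)^{-1}$, $(\overline h)^S=F(\overline h)(\overline{h^S})$. For a leg $l$ of $X$ whose preimages are legs of $Y$, choose a leg $l^S$ above $l$ rooted at $r(l)^T$ and set $F(l)=1$. For a leg $l$ of $X$ whose preimages belong to edges of $Y$, choose an edge $\{h,\overline h\}$ of $Y$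 with $\pi(h)=l$, $r(h)=r(l)^T$, set $l^S=h$, and let $F(l)$ be the unique (order 2) element of $G$ sending $h$ to $\overline h$. All these choices are fixed. The Frobenius element of a path $Q=g_0h_1g_1\cdots g_{n-1}h_n$ in $\mathbb{X}$ is $F(Q)=g_0F(h_1)g_1F(h_2)\cdots g_{n-1}F(h_n)\in G$. For a finite-dimensional complex representation $\rho$ of $G$ of degree $d$, the Artin–Ihara $L$-function is $$L(u,\rho,Y/\mathbb{X})=\prod_{\mathfrak q}\det\bigl(I_d-\rho(F(Q))u^{\ell(Q)}\bigr)^{-1},$$ the product over all primes $\mathfrak q$ of $\mathbb{X}$, where $Q$ is an arbitrary representative of $\mathfrak q$ (different representatives have conjugate Frobenius elements). All products converge for sufficiently small complex $u$. *)

(* Defs.v *)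
From HB Require Import structures.
From mathcomp Require Import all_boot all_order all_algebra fingroup.
From mathcomp Require Import mxrepresentation generic_quotient finmap complex.
From mathcomp Require Import boolp classical_sets filter reals topology.
From mathcomp Require Import normedtype summability.

Set Implicit Arguments.
Unset Strict Implicit.
Unset Printing Implicit Defensive.

Import GRing.Theory Num.Theory.

Local Open Scope quotient_scope.

Record graph := Graph {
  vertex : finType;
  halfedge : finType;
  root : halfedge -> vertex;
  bar : halfedge -> halfedge;
  barK : involutive bar
}.

Section Graphs.
Variable X : graph.
Implicit Types (v w : vertex X) (h : halfedge X) (p : seq (halfedge X)).

Definition adjacent_in (E : {set halfedge X}) v w :=
  [exists h in E, (root h == v) && (root (bar h) == w)].

Definition connected_by (E : {set halfedge X}) :=
  forall v w, connect (adjacent_in E) v w.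

Definition connected_graph := connected_by [set: halfedge X].

Definition composable h h' := root h' == root (bar h).

Definition is_path p := (p != [::]) && sorted composable p.

(* [path.cycle] also relates the last entry to the first one, which is the
   convention "indices mod n". *)
Definition closed_path p := (p != [::]) && path.cycle composable p.

Definition reduced p := path.cycle (fun h h' => h' != bar h) p.

Definition primitive_path p : bool :=
  [&& closed_path p, reduced p &
      `[< ~ exists s k, [/\ is_path s, 2 <= k & p = flatten (nseq k s)] >]].

(* A spanning tree contains all vertices, so it is given by its half-edges.
   It has edges only, no legs. *)
Definition spanning_tree (E : {set halfedge X}) :=
  [/\ forall h, h \in E -> bar h \in E,
      forall h, h \in E -> bar h != h,
      connected_by E
    & forall p, closed_path p -> reduced p -> ~~ all (mem E) p].

End Graphs.

Section CyclicClasses.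
Variables (T : choiceType) (P : pred (seq T)).

Definition cyclic_shift (p q : {p : seq T | P p}) : bool :=
  `[< exists k, val q = rot k (val p) >].

Lemma cyclic_shift_refl : reflexive cyclic_shift.
Proof. by move=> p; apply/asboolP; exists 0; rewrite rot0. Qed.

Lemma cyclic_shift_sym : symmetric cyclic_shift.
Proof.
suff sub p q : cyclic_shift p q -> cyclic_shift q p.
  by move=> p q; apply/idP/idP; apply: sub.
move=> /asboolP[k qE]; apply/asboolP; exists (size (val q) - k).
by rewrite -/(rotr k (val q)) qE rotK.
Qed.

Lemma cyclic_shift_trans : transitive cyclic_shift.
Proof.
move=> q p s /asboolP[k qE] /asboolP[l sE]; apply/asboolP.
have [lek|/ltnW gek] := leqP k (size (val p)); last first.
  by exists l; rewrite sE qE (rot_oversize gek).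
have [lel|/ltnW gel] := leqP l (size (val p)); last first.
  by exists k; rewrite sE rot_oversize // qE size_rot.
by rewrite sE qE rot_add_mod //; eexists.
Qed.

Canonical cyclic_shift_equiv :=
  EquivRel cyclic_shift cyclic_shift_refl cyclic_shift_sym cyclic_shift_trans.

Definition cyclic_class := {eq_quot cyclic_shift}.

HB.instance Definition _ := Choice.on cyclic_class.
HB.instance Definition _ := EqQuotient.on cyclic_class.

Definition representative (c : cyclic_class) : seq T := val (repr c).

End CyclicClasses.

Definition prime_path (X : graph) := cyclic_class (@primitive_path X).

(* The vertex groups are given inside a common group, so that the elements
   occurring in a path have one type. *)
Record graph_of_groups (gT : finGroupType) := GraphOfGroups {
  underlying : graph;
  vertex_group : vertex underlying -> {group gT}
}.

Section GraphsOfGroups.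
Variables (gT : finGroupType) (XX : graph_of_groups gT).
Local Notation X := (underlying XX).
Implicit Types p : seq (gT * halfedge X).

(* The path g_0 h_1 g_1 h_2 ... g_{n-1} h_n is the sequence of the pairs
   (g_{j-1}, h_j).  Since r(h_{j+1}) = r(bar h_j), every g_{j-1} lies in the
   group of the vertex r(h_j). *)
Definition gg_path p :=
  is_path (unzip2 p) && all (fun x => x.1 \in vertex_group (root x.2)) p.

Definition gg_closed_path p := gg_path p && closed_path (unzip2 p).

(* Here g_n means g_0. *)
Definition gg_reduced p :=
  path.cycle (fun x y => (y.2 != bar x.2) || (y.1 != 1%g)) p.

Definition gg_primitive_path p : bool :=
  [&& gg_closed_path p, gg_reduced p &
      `[< ~ exists s k, [/\ gg_path s, 2 <= k & p = flatten (nseq k s)] >]].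

Definition gg_prime := cyclic_class gg_primitive_path.

End GraphsOfGroups.

(* Left actions; the actions of [fingroup.action] are right actions. *)
Record graph_action (gT : finGroupType) (Y : graph) := GraphAction {
  actV : gT -> vertex Y -> vertex Y;
  actH : gT -> halfedge Y -> halfedge Y;
  actV1 : forall v, actV 1%g v = v;
  actVM : forall a b v, actV (a * b)%g v = actV a (actV b v);
  actH1 : forall h, actH 1%g h = h;
  actHM : forall a b h, actH (a * b)%g h = actH a (actH b h);
  act_root : forall a h, root (actH a h) = actV a (root h);
  act_bar : forall a h, bar (actH a h) = actH a (bar h)
}.

Section Quotient.
Variables (gT : finGroupType) (Y : graph) (A : graph_action gT Y).

Definition edge_free := forall a h, actH A a h = h -> a = 1%g.

Definition same_orbitV : rel (vertex Y) := fun v w => [exists a, actV A a v == w].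
Definition same_orbitH : rel (halfedge Y) := fun h k => [exists a, actH A a h == k].

Lemma same_orbitV_equiv : equiv_class_of same_orbitV.
Proof.
split=> [v|v w|w v x].
- by apply/existsP; exists 1%g; rewrite actV1.
- apply/existsP/existsP=> -[a /eqP <-]; exists a^-1%g;
    by rewrite -actVM mulVg actV1.
- move=> /existsP[a /eqP <-] /existsP[b /eqP <-].
  by apply/existsP; exists (b * a)%g; rewrite actVM.
Qed.

Lemma same_orbitH_equiv : equiv_class_of same_orbitH.
Proof.
split=> [v|v w|w v x].
- by apply/existsP; exists 1%g; rewrite actH1.
- apply/existsP/existsP=> -[a /eqP <-]; exists a^-1%g;
    by rewrite -actHM mulVg actH1.
- move=> /existsP[a /eqP <-] /existsP[b /eqP <-].
  by apply/existsP; exists (b * a)%g; rewrite actHM.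
Qed.

Canonical same_orbitV_rel := EquivRelPack same_orbitV_equiv.
Canonical same_orbitH_rel := EquivRelPack same_orbitH_equiv.

Definition orbitV := {eq_quot same_orbitV}.
HB.instance Definition _ := EqQuotient.on orbitV.
HB.instance Definition _ := Choice.on orbitV.

Let reprV (x : orbitV) : vertex Y := repr x.
Let reprVK : cancel reprV \pi_orbitV. Proof. exact: reprK. Qed.
HB.instance Definition _ : isCountable orbitV := CanIsCountable reprVK.
HB.instance Definition _ : isFinite orbitV := CanIsFinite reprVK.

Definition orbitH := {eq_quot same_orbitH}.
HB.instance Definition _ := EqQuotient.on orbitH.
HB.instance Definition _ := Choice.on orbitH.

Let reprH (x : orbitH) : halfedge Y := repr x.
Let reprHK : cancel reprH \pi_orbitH. Proof. exact: reprK. Qed.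
HB.instance Definition _ : isCountable orbitH := CanIsCountable reprHK.
HB.instance Definition _ : isFinite orbitH := CanIsFinite reprHK.

Definition quotient_root (h : orbitH) : orbitV := \pi_orbitV (root (repr h)).
Definition quotient_bar (h : orbitH) : orbitH := \pi_orbitH (bar (repr h)).

Lemma quotient_root_pi h : quotient_root (\pi_orbitH h) = \pi_orbitV (root h).
Proof.
apply/eqmodP; rewrite /=; case: piP => k /eqmodP /existsP[a /eqP <-].
by rewrite act_root; apply/existsP; exists a^-1%g; rewrite -actVM mulVg actV1.
Qed.

Lemma quotient_bar_pi h : quotient_bar (\pi_orbitH h) = \pi_orbitH (bar h).
Proof.
apply/eqmodP; rewrite /=; case: piP => k /eqmodP /existsP[a /eqP <-].
by rewrite act_bar; apply/existsP; exists a^-1%g; rewrite -actHM mulVg actH1.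
Qed.

Lemma quotient_barK : involutive quotient_bar.
Proof.
by move=> h; rewrite [X in quotient_bar X]/quotient_bar quotient_bar_pi barK reprK.
Qed.

Definition quotient_graph : graph :=
  @Graph orbitV orbitH quotient_root quotient_bar quotient_barK.

Definition projV (v : vertex Y) : vertex quotient_graph := \pi_orbitV v.
Definition projH (h : halfedge Y) : halfedge quotient_graph := \pi_orbitH h.

Definition stabilizer (v : vertex Y) : {set gT} :=
  [set a | actV A a v == v]%SET.

Lemma stabilizer_group_set v : group_set (stabilizer v).
Proof.
apply/group_setP; split=> [|a b]; first by rewrite inE actV1.
by rewrite !inE => /eqP ha /eqP hb; rewrite actVM hb ha.
Qed.

Canonical stabilizer_group v := Group (stabilizer_group_set v).

End Quotient.

Record quotient_choices (gT : finGroupType) (Y : graph)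
    (A : graph_action gT Y) := QuotientChoices {
  tree : {set halfedge (quotient_graph A)};
  treeP : spanning_tree tree;
  (* v^T, h^S and F(h) *)
  liftV : vertex (quotient_graph A) -> vertex Y;
  liftH : halfedge (quotient_graph A) -> halfedge Y;
  frobH : halfedge (quotient_graph A) -> gT;
  projV_lift : forall v, projV A (liftV v) = v;
  projH_lift : forall h, projH A (liftH h) = h;
  root_lift : forall h, root (liftH h) = liftV (root h);
  (* Together with the three fields above, this says that liftV and liftH
     embed the tree in Y; its image is T. *)
  tree_lift : forall h, h \in tree -> liftH (bar h) = bar (liftH h);
  tree_frob : forall h, h \in tree -> frobH h = 1%g;
  orientation : {set halfedge (quotient_graph A)};
  orientationP : forall h, h \notin tree -> bar h != h ->
    (h \in orientation) (+) (bar h \in orientation);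
  edge_frob : forall h, h \notin tree -> bar h != h -> h \in orientation ->
    [/\ actV A (frobH h) (liftV (root (bar h))) = root (bar (liftH h)),
        frobH (bar h) = (frobH h)^-1%g
      & liftH (bar h) = actH A (frobH (bar h)) (bar (liftH h))];
  leg_frob : forall l, bar l = l ->
    (forall h, projH A h = l -> bar h = h) -> frobH l = 1%g;
  folded_leg_frob : forall l, bar l = l ->
    (forall h, projH A h = l -> bar h != h) ->
    actH A (frobH l) (liftH l) = bar (liftH l)
}.

Definition quotient_gg (gT : finGroupType) (Y : graph) (A : graph_action gT Y)
    (S : quotient_choices A) : graph_of_groups gT :=
  @GraphOfGroups gT (quotient_graph A)
    (fun v => stabilizer_group A (liftV S v)).

Definition frobenius (gT : finGroupType) (Y : graph) (A : graph_action gT Y)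
    (S : quotient_choices A) (Q : seq (gT * halfedge (quotient_graph A))) : gT :=
  (\prod_(x <- Q) (x.1 * frobH S x.2))%g.

Lemma frobenius_cat (gT : finGroupType) (Y : graph) (A : graph_action gT Y)
    (S : quotient_choices A) P Q :
  frobenius S (P ++ Q) = (frobenius S P * frobenius S Q)%g.
Proof. by rewrite /frobenius big_cat. Qed.

Local Open Scope ring_scope.

Section Factors.
Variables (C : fieldType) (gT : finGroupType) (Y : graph).
Variables (A : graph_action gT Y) (S : quotient_choices A) (d : nat).
Variable rho : mx_representation C [set: gT]%G d.

Definition zeta_factor (u : C) (p : prime_path Y) : C :=
  (1 - u ^+ size (representative p))^-1.

Definition L_term (u : C) (Q : seq (gT * halfedge (quotient_graph A))) : C :=
  (\det (1%:M - u ^+ size Q *: rho (frobenius S Q)))^-1.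

Lemma L_term_rot (u : C) k Q : L_term u (rot k Q) = L_term u Q.
Proof.
rewrite /L_term size_rot /rot frobenius_cat -[in RHS](cat_take_drop k Q).
rewrite frobenius_cat size_cat -size_cat cat_take_drop.
move: (frobenius S (take k Q)) (frobenius S (drop k Q)) => x y.
rewrite !repr_mxM ?finset.in_setT //; congr _^-1; set c := u ^+ _.
have ux : rho x \in unitmx by apply/repr_mx_unit/finset.in_setT.
have -> : 1%:M - c *: (rho x *m rho y) =
    rho x *m (1%:M - c *: (rho y *m rho x)) *m invmx (rho x).
  rewrite mulmxBr mulmx1 mulmxBl mulmxV // -scalemxAr -scalemxAl.
  by rewrite mulmxA mulmxK.
by rewrite !det_mulmx mulrAC -det_mulmx mulmxV // det1 mul1r.
Qed.

(* By L_term_rot the choice of the representative is irrelevant. *)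
Definition L_factor (u : C) (q : gg_prime (quotient_gg S)) : C :=
  L_term u (representative q).

End Factors.

Arguments zeta_factor {C} Y u p.
Arguments L_factor {C gT Y A} S {d} rho u q.

(* Row g of [regular_repr] at x is the basis vector indexed by g * x; hence
   on functions f : G -> C, seen as columns, x acts by (x f)(g) = f(g x). *)
Definition right_regular_repr (C : fieldType) (gT : finGroupType) :
    mx_representation C [set: gT]%G #|[set: gT]%G| :=
  regular_repr C [set: gT]%G.

Import numFieldNormedType.Exports.

Section Products.
Local Open Scope classical_set_scope.
Variables (C : numClosedFieldType) (I : choiceType) (f : I -> C).

Definition partial_prod (J : {fset I}) : C := \prod_(i : J) f (val i).

Definition cvg_prod := cvg (partial_prod @ totally).

(* The unordered product over I: the limit of the products over the finite
   subsets of I.  It is meaningful only when [cvg_prod] holds. *)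
Definition unordered_prod : C := lim (partial_prod @ totally).

End Products.

Definition ihara_zeta (C : numClosedFieldType) (Y : graph) (u : C) : C :=
  unordered_prod (zeta_factor Y u).

Definition artin_ihara_L (C : numClosedFieldType) (gT : finGroupType)
    (Y : graph) (A : graph_action gT Y) (S : quotient_choices A) (d : nat)
    (rho : mx_representation C [set: gT]%G d) (u : C) : C :=
  unordered_prod (L_factor S rho u).

(* R[i] has its norm topology only once it is seen as a
   [numClosedFieldType]. *)
Definition Cplx (R : realType) : numClosedFieldType := R[i]%C.

(* Main.v *)
(** A graph with a free action on half-edges is, as far as reduced paths are
concerned, a voltage cover of the quotient graph of groups: once b in G is
chosen, a path of Y // G starting at v has a unique lift to Y with base b v^T,
and a reduced closed path Q lifts to a reduced closed path exactly when F(Q) =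
1. Hence the primes of Y above the prime of Q are the lifts of Q^f, where f is
the order of F(Q), with one prime for each orbit of right multiplication by
F(Q) on G. Since det(1 - c rho_G(x)) is the product of (1 - c^|o|) over the
orbits o of right multiplication by x, each factor of the L-function is the
product of the zeta factors of the primes above. So the partial products of L
are partial products of zeta, and both converge to the same limit once zeta
converges unconditionally, which holds for small u because Y has at most
|H(Y)|^n primes of length n. *)

From mathcomp Require Import all_boot all_order all_algebra fingroup perm cyclic.
From mathcomp Require Import mxrepresentation generic_quotient finmap complex.
From mathcomp Require Import boolp classical_sets filter reals topology.
From mathcomp Require Import normedtype summability.
From mathcomp Require Import zify ring lra.
Require Import Defs.

Set Implicit Arguments.
Unset Strict Implicit.
Unset Printing Implicit Defensive.

Import Order.TTheory GRing.Theory Num.Theory.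
Import numFieldNormedType.Exports.

Local Open Scope quotient_scope.

(** * Powers, roots and cyclic shifts of words *)

Section Words.
Variable T : eqType.
Implicit Types (s t w x y z : seq T).

Definition power s k := flatten (nseq k s).

Lemma powerS s k : power s k.+1 = s ++ power s k. Proof. by []. Qed.

Lemma power1 s : power s 1 = s. Proof. by rewrite /power /= cats0. Qed.

Lemma powerD s j k : power s (j + k) = power s j ++ power s k.
Proof. by rewrite /power nseqD flatten_cat. Qed.

Lemma powerSr s k : power s k.+1 = power s k ++ s.
Proof. by rewrite -addn1 powerD power1. Qed.

Lemma powerM s j k : power s (j * k) = power (power s j) k.
Proof. by elim: k => [|k IH]; rewrite ?muln0 // mulnS powerD IH. Qed.

Lemma size_power s k : size (power s k) = k * size s.
Proof. by elim: k => // k IH; rewrite powerS size_cat IH mulSn. Qed.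

Lemma power_eq0 s k : 0 < k -> (power s k == [::]) = (s == [::]).
Proof. by move=> k0; rewrite -!size_eq0 size_power muln_eq0 eqn0Ngt k0. Qed.

(** Euclid's algorithm on the lengths: the shorter word is a prefix of the longer one and commutes
    with what is left once that prefix is deleted. *)
Lemma cat_comm_power s t : s ++ t = t ++ s ->
  exists z, exists j k, s = power z j /\ t = power z k.
Proof.
have [n] := ubnP (size s + size t); elim: n s t => // n IH s t.
wlog st : s t / size s <= size t.
  move=> wl le_n e; have [st|/ltnW ts] := leqP (size s) (size t).
    exact: wl.
  rewrite addnC in le_n; have [z [j [k [-> ->]]]] := wl t s ts le_n (esym e).
  by exists z, k, j.
move=> le_n e; have [s0|s_neq0] := eqVneq s [::].
  by exists t, 0, 1; rewrite power1 s0.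
have tE : t = s ++ drop (size s) t.
  have := congr1 (take (size s)) e.
  by rewrite take_size_cat // takel_cat // => {1}->; rewrite cat_take_drop.
move: e; rewrite tE -catA => /eqP; rewrite eqseq_cat // eqxx /= => /eqP e.
have [|z [j [k [sE dE]]]] := IH s (drop (size s) t) _ e.
  by move: le_n s_neq0; rewrite size_drop -size_eq0; lia.
by exists z, j, (j + k); rewrite powerD -dE -sE.
Qed.

(** The square of the common power begins both with [s ++ t] and with [t ++ s], which have the same
    length. *)
Lemma power_eq_cat_comm s t j k : 0 < j -> 0 < k ->
  power s j = power t k -> s ++ t = t ++ s.
Proof.
have expand x y l m : 0 < l -> 0 < m -> power x l = power y m ->
    exists w, power x (l * 2) = (x ++ y) ++ w.
  move=> l0 m0 e; exists (power y m.-1 ++ power x l.-1).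
  have -> : l * 2 = 1 + (l + l.-1) by lia.
  by rewrite !powerD power1 e -{1}(prednK m0) powerS !catA.
move=> j0 k0 e.
have [u uE] := expand s t j k j0 k0 e.
have [v vE] := expand t s k j k0 j0 (esym e).
have : power s (j * 2) = power t (k * 2) by rewrite !powerM e.
rewrite uE vE => /eqP; rewrite eqseq_cat; first by case/andP=> /eqP.
by rewrite !size_cat addnC.
Qed.

(** Allowing [k = 0] rules out the empty word, which is a zeroth power. *)
Definition aperiodic s := forall t k, s = power t k -> k = 1.

Lemma aperiodic_neq0 s : aperiodic s -> s != [::].
Proof. by move=> sP; apply/eqP=> s0; have := sP [::] 0 s0. Qed.

Lemma aperiodicP s : s != [::] ->
  aperiodic s <-> ~ exists t k, 2 <= k /\ s = power t k.
Proof.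
move=> s0; split=> [sP [t [k [k2 sE]]]|sP t k sE].
  by rewrite (sP t k sE) in k2.
apply: contrapT => k1; apply: sP; exists t, k; split=> //.
by case: k sE k1 => [sE|[|]] //; rewrite sE in s0.
Qed.

Lemma aperiodic_root s : s != [::] ->
  exists t k, [/\ aperiodic t, 0 < k & s = power t k].
Proof.
have [n] := ubnP (size s); elim: n s => // n IH s le_n s0.
have [sP|] := pselect (aperiodic s).
  by exists s, 1; rewrite power1.
move=> /(aperiodicP s0) /contrapT [t [k [k2 sE]]].
have t0 : t != [::] by rewrite -(power_eq0 t (ltnW k2)) -sE.
have [|r [m [rP m0 tE]]] := IH t _ t0.
  move: le_n; rewrite sE size_power ltnS; apply: leq_trans.
  by rewrite -[ltnLHS]mul1n ltn_mul2r k2 lt0n size_eq0 t0.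
exists r, (m * k); split=> //; first by rewrite muln_gt0 m0 ltnW.
by rewrite powerM -tE.
Qed.

(** The two words commute, hence are powers of one word, which aperiodicity identifies with [s]. *)
Lemma power_eq_aperiodic s t j k : aperiodic s -> 0 < j -> 0 < k ->
  power s j = power t k -> exists m, t = power s m.
Proof.
move=> sP j0 k0 /(power_eq_cat_comm j0 k0)/cat_comm_power[z [l [m [sE ->]]]].
by exists m; rewrite sE (sP _ _ sE) power1.
Qed.

Lemma power_inj s j k : s != [::] -> power s j = power s k -> j = k.
Proof.
move=> s0 /(congr1 size)/eqP; rewrite !size_power eqn_pmul2r ?lt0n ?size_eq0 //.
by move/eqP.
Qed.

(** [rot k] is the identity once [k] exceeds the size; iterating [rot 1] instead gives an additive
    action of all natural numbers. *)
Definition shift k s := iter k (rot 1) s.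

Lemma size_shift k s : size (shift k s) = size s.
Proof. by elim: k => //= k IH; rewrite size_rot. Qed.

Lemma shiftD j k s : shift (j + k) s = shift j (shift k s).
Proof. exact: iterD. Qed.

Lemma shift_rot k s : k <= size s -> shift k s = rot k s.
Proof.
elim: k => [|k IH] ks; first by rewrite rot0.
by rewrite rotS //= -/(shift k s) IH // ltnW.
Qed.

Lemma shift_size s : shift (size s) s = s.
Proof. by rewrite shift_rot // rot_size. Qed.

Lemma shift_mul_size k s : shift (k * size s) s = s.
Proof. by elim: k => // k IH; rewrite mulSn shiftD IH shift_size. Qed.

Lemma shiftP s t : (exists k, t = rot k s) <-> exists k, t = shift k s.
Proof.
split=> -[k ->].
  have [ks|ks] := leqP k (size s); first by exists k; rewrite shift_rot.
  by exists 0; rewrite rot_oversize // ltnW.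
elim: k => [|k [j /= jE]]; first by exists 0; rewrite rot0.
rewrite -/(shift k s) jE; have [js|/ltnW js] := leqP j (size s); last first.
  by exists 1; rewrite (rot_oversize js).
have [s1|] := leqP 1 (size s); last by case: (s) => // _; exists 0.
by rewrite rot_add_mod //; eexists.
Qed.

Lemma shift_power k s j : shift k (power s j) = power (shift k s) j.
Proof.
have rot_power a t i : rot 1 (power (a :: t) i) = power (rot 1 (a :: t)) i.
  case: i => // i; rewrite !powerS /= !rot1_cons -!cats1.
  have e : power (a :: t) i ++ [:: a] = a :: power (t ++ [:: a]) i.
    by elim: i => // i IH; rewrite powerS -catA IH powerS /= -!catA.
  by rewrite -catA e -catA.
elim: k => //= k ->; case: (shift k s) => [|a t]; last exact: rot_power.
by rewrite /power; elim: j.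
Qed.

Lemma aperiodic_shift k s : aperiodic s -> aperiodic (shift k s).
Proof.
move=> sP t j tE.
(* This further shift completes [shift k] to [k] full turns. *)
apply: (sP (shift (k * (size s).-1) t)); rewrite -shift_power -tE -shiftD.
rewrite addnC -mulnS prednK ?lt0n ?size_eq0 ?aperiodic_neq0 //.
by rewrite shift_mul_size.
Qed.

(** Let r be the remainder of [k] by the size. The prefix of length r commutes with the remaining
    suffix, so both are powers of one word; aperiodicity leaves one of them empty, and the suffix is
    not. *)
Lemma aperiodic_shift_id k s : aperiodic s -> shift k s = s -> size s %| k.
Proof.
move=> sP; have n0 : 0 < size s by rewrite lt0n size_eq0 aperiodic_neq0.
rewrite {1}(divn_eq k (size s)) addnC shiftD shift_mul_size.
have lt_r := ltn_pmod k n0; rewrite shift_rot 1?ltnW // => e.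
have : drop (k %% size s) s ++ take (k %% size s) s =
    take (k %% size s) s ++ drop (k %% size s) s by rewrite cat_take_drop.
case/cat_comm_power=> z [i [j [dE tE]]].
have : s = power z (j + i) by rewrite powerD -dE -tE cat_take_drop.
move/sP; case: j tE => [|[|j]] tE.
- move/(congr1 size): tE; rewrite size_power size_takel 1?ltnW // => /eqP r0.
  by rewrite /dvdn r0.
- case: i dE => // /(congr1 size)/eqP; rewrite size_power mul0n size_drop.
  by rewrite subn_eq0 leqNgt lt_r.
by [].
Qed.

End Words.

Section CyclicWords.
Variable T : eqType.
Implicit Types (e : rel T) (s : seq T).

Lemma cycle_all (P : pred T) s : path.cycle (fun _ y => P y) s = all P s.
Proof.
case: s => //= x s; have pathE z t : path (fun _ y => P y) z t = all P t.
  by elim: t z => //= y t IH z; rewrite IH.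
by rewrite pathE all_rcons.
Qed.

Lemma cycle_sorted e s : path.cycle e s -> sorted e s.
Proof. by case: s => //= x s; rewrite rcons_path => /andP[]. Qed.

(** Each junction of two consecutive copies is the wrap-around step of a single copy. *)
Lemma cycle_power e s k : 0 < k -> path.cycle e (power s k) = path.cycle e s.
Proof.
case: s => [|x s] k0; first by rewrite /power; elim: k {k0}.
have path_power j :
    path e x (rcons (s ++ power (x :: s) j) x) = path e x (rcons s x).
  elim: j => [|j IH]; first by rewrite cats0.
  by rewrite powerS -cat_rcons rcons_cat cat_path last_rcons IH andbb.
by case: k k0 => // k _; exact: path_power.
Qed.

End CyclicWords.

(** * Reduced paths and their lifts *)

Section PrimitivePaths.

(** With both conditions in one relation, a closed reduced path is a nonempty [path.cycle]. *)
Definition reduced_step (Y : graph) : rel (halfedge Y) :=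
  [rel h h' | composable h h' && (h' != bar h)].

(** By [cycle_power] any root of a closed path is itself a closed path, so primitivity amounts to
    aperiodicity of the word. *)
Lemma primitive_pathP (Y : graph) (p : seq (halfedge Y)) :
  primitive_path p <->
  [/\ p != [::], path.cycle (@reduced_step Y) p & aperiodic p].
Proof.
have red : (p != [::]) && path.cycle (@reduced_step Y) p =
    closed_path p && reduced p.
  by rewrite /closed_path -andbA -cycle_relI.
rewrite /primitive_path andbA -red; split.
  case/andP=> /andP[p0 cp] /asboolP np; split=> //; apply/aperiodicP => //.
  move=> -[s [k [k2 pE]]]; apply: np; exists s, k; split=> //.
  have k0 : 0 < k by apply: ltnW.
  have s0 : s != [::] by rewrite -(power_eq0 s k0) -pE.
  have : path.cycle (@composable Y) s.
    by move: cp; rewrite pE cycle_power // cycle_relI => /andP[].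
  by rewrite /is_path s0 => /cycle_sorted.
case=> p0 cp /(aperiodicP p0) np; rewrite p0 cp /=; apply/asboolP.
by move=> -[s [k [_ k2 pE]]]; apply: np; exists s, k.
Qed.

Variables (gT : finGroupType) (XX : graph_of_groups gT).

(** Membership is tested on the second pair only: around a cycle every pair comes second once. *)
Definition gg_reduced_step : rel (gT * halfedge (underlying XX)) :=
  [rel x y | composable x.2 y.2 && (y.1 \in vertex_group (root y.2))
     && ((y.2 != bar x.2) || (y.1 != 1%g))].

Lemma gg_primitive_pathP (p : seq (gT * halfedge (underlying XX))) :
  gg_primitive_path p <->
  [/\ p != [::], path.cycle gg_reduced_step p & aperiodic p].
Proof.
have redE q : (q != [::]) && path.cycle gg_reduced_step q =
    gg_closed_path q && gg_reduced q.
  rewrite !cycle_relI (cycle_all (fun y => y.1 \in vertex_group (root y.2))).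
  rewrite /gg_closed_path /gg_path /closed_path /is_path cycle_map.
  rewrite -!size_eq0 size_map /gg_reduced.
  have [cp|] := boolP (path.cycle (relpre snd _) q); last by rewrite !andbF.
  rewrite (cycle_sorted (e := @composable _)) ?cycle_map //.
  by case: (size q == 0); rewrite /= ?andbT.
rewrite /gg_primitive_path andbA -redE; split.
  case/andP=> /andP[p0 cp] /asboolP np; split=> //; apply/aperiodicP => //.
  move=> -[s [k [k2 pE]]]; apply: np; exists s, k; split=> //.
  have k0 : 0 < k by apply: ltnW.
  have s0 : s != [::] by rewrite -(power_eq0 s k0) -pE.
  have : (s != [::]) && path.cycle gg_reduced_step s.
    by rewrite s0; move: cp; rewrite pE cycle_power.
  by rewrite redE => /andP[/andP[]].
case=> p0 cp /(aperiodicP p0) np; rewrite p0 cp /=; apply/asboolP.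
by move=> -[s [k [_ k2 pE]]]; apply: np; exists s, k.
Qed.

End PrimitivePaths.

Section Lifting.
Variables (gT : finGroupType) (Y : graph) (A : graph_action gT Y).
Variable S : quotient_choices A.
Hypothesis freeA : edge_free A.
Local Notation X := (quotient_graph A).
Local Notation XX := (quotient_gg S).
Local Notation F := (frobenius S).
Implicit Types (a b : gT) (h : halfedge X) (y : halfedge Y).
Implicit Types (Q : seq (gT * halfedge X)) (p : seq (halfedge Y)).
Local Open Scope group_scope.

Lemma actVK a : cancel (actV A a) (actV A a^-1).
Proof. by move=> v; rewrite -actVM mulVg actV1. Qed.

Lemma actHK a : cancel (actH A a) (actH A a^-1).
Proof. by move=> h; rewrite -actHM mulVg actH1. Qed.

Lemma projV_act a (v : vertex Y) : projV A (actV A a v) = projV A v.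
Proof. by apply/eqmodP/existsP; exists a^-1; rewrite actVK. Qed.

Lemma projH_act a y : projH A (actH A a y) = projH A y.
Proof. by apply/eqmodP/existsP; exists a^-1; rewrite actHK. Qed.

Lemma actH_inj_elt a b y : actH A a y = actH A b y -> a = b.
Proof.
move=> e; apply/esym/eqP; rewrite eq_mulVg1; apply/eqP/(freeA (h := y)).
by rewrite actHM e actHK.
Qed.

(** Tree edges, oriented and reversed edges, legs and folded legs all obey this rule, the one
    property of [frobH] on which the lifting rests. *)
Lemma bar_liftH h : bar (liftH S h) = actH A (frobH S h) (liftH S (bar h)).
Proof.
have [ht|ht] := boolP (h \in tree S).
  by rewrite tree_frob // actH1 tree_lift.
have [hl|hl] := eqVneq (bar h) h.
  (* The preimages of [h] form one orbit, so they are all legs or none is. *)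
  have [leg|noleg] := eqVneq (bar (liftH S h)) (liftH S h).
    rewrite hl leg leg_frob ?actH1 // => y yh.
    have /eqmodP/existsP[a /eqP <-] : projH A (liftH S h) = projH A y.
      by rewrite projH_lift yh.
    by rewrite act_bar leg.
  rewrite hl folded_leg_frob // => y yh.
  have /eqmodP/existsP[a /eqP yE] : projH A y = projH A (liftH S h).
    by rewrite projH_lift yh.
  by apply: contraNneq noleg => barl; rewrite -yE act_bar barl.
have bht : bar h \notin tree S.
  by apply: contraNN ht => /(let: And4 t _ _ _ := treeP S in t); rewrite barK.
have blh : bar (bar h) != bar h by rewrite barK eq_sym.
have [ho|ho] := boolP (h \in orientation S).
  have [_ FV ->] := edge_frob ht hl ho.
  by rewrite -actHM FV mulgV actH1.
have bho : bar h \in orientation S.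
  by have := orientationP (q := S) ht hl; rewrite (negPf ho).
have [_] := edge_frob bht blh bho; rewrite barK => FV ->.
by rewrite act_bar barK.
Qed.

Lemma root_bar_liftH h :
  root (bar (liftH S h)) = actV A (frobH S h) (liftV S (root (bar h))).
Proof. by rewrite bar_liftH act_root root_lift. Qed.

(** By freeness a -> a h^S is a bijection from G onto the fibre over h; this is its inverse. By
    [coset_eltP] the default 1 is never reached. *)
Definition coset_elt y : gT :=
  odflt 1 [pick a | actH A a (liftH S (projH A y)) == y].

Lemma coset_eltP y : actH A (coset_elt y) (liftH S (projH A y)) = y.
Proof.
rewrite /coset_elt; case: pickP => [a /eqP //|no].
have /eqmodP/existsP[a ay] : projH A (liftH S (projH A y)) = projH A y.
  exact: projH_lift.
by have := no a; rewrite ay.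
Qed.

Lemma projH_act_lift b h : projH A (actH A b (liftH S h)) = h.
Proof. by rewrite projH_act projH_lift. Qed.

Lemma coset_elt_act b h : coset_elt (actH A b (liftH S h)) = b.
Proof.
by apply: (@actH_inj_elt _ _ (liftH S h)); rewrite -[RHS]coset_eltP projH_act_lift.
Qed.

(* A point of Y over v is given as b v^T with b in G. The choice of b matters:
   [endpoint y] is the one reached by following F along y. *)
Definition endpoint y : gT := coset_elt y * frobH S (projH A y).

(** [lift b] and [descend b] are mutually inverse on arbitrary words; the conditions of being closed
    and reduced are compared in [cycle_lift]. *)
Fixpoint lift b Q : seq (halfedge Y) :=
  if Q is x :: Q' then
    actH A (b * x.1) (liftH S x.2) :: lift (b * x.1 * frobH S x.2) Q'
  else [::].

Fixpoint descend b p : seq (gT * halfedge X) :=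
  if p is y :: p' then
    (b^-1 * coset_elt y, projH A y) :: descend (endpoint y) p'
  else [::].

Lemma frobenius_nil : F [::] = 1. Proof. exact: big_nil. Qed.

Lemma frobenius_cons x Q : F (x :: Q) = x.1 * frobH S x.2 * F Q.
Proof. exact: big_cons. Qed.

Lemma frobenius_power Q k : F (power Q k) = F Q ^+ k.
Proof.
elim: k => [|k IH]; first by rewrite frobenius_nil.
by rewrite powerS frobenius_cat IH expgS.
Qed.

Lemma size_lift b Q : size (lift b Q) = size Q.
Proof. by elim: Q b => //= x Q IH b; rewrite IH. Qed.

Lemma lift_cat b Q Q' : lift b (Q ++ Q') = lift b Q ++ lift (b * F Q) Q'.
Proof.
elim: Q b => [|x Q IH] b /=; first by rewrite frobenius_nil mulg1.
by rewrite IH frobenius_cons !mulgA.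
Qed.

Lemma lift_power b Q k : F Q = 1 -> lift b (power Q k) = power (lift b Q) k.
Proof.
by move=> F1; elim: k => // k IH; rewrite !powerS lift_cat F1 mulg1 IH.
Qed.

Lemma endpoint_act b h : endpoint (actH A b (liftH S h)) = b * frobH S h.
Proof. by rewrite /endpoint coset_elt_act projH_act_lift. Qed.

Lemma liftK b Q : descend b (lift b Q) = Q.
Proof.
elim: Q b => //= -[a h] Q IH b /=.
by rewrite endpoint_act IH coset_elt_act projH_act_lift mulKg.
Qed.

Lemma descendK b p : lift b (descend b p) = p.
Proof.
by elim: p b => //= y p IH b; rewrite mulKVg coset_eltP -/(endpoint y) IH.
Qed.

Lemma lift_rcons b Q x :
  lift b (rcons Q x) = rcons (lift b Q) (actH A (b * F Q * x.1) (liftH S x.2)).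
Proof. by rewrite -cats1 lift_cat /= cats1. Qed.

(** As F(Q) = 1, the base after the last half-edge is again [b], and [endpoint] reads it off that
    half-edge; [liftK] then recovers the word. *)
Lemma lift_inj b b' Q Q' : Q != [::] -> F Q = 1 -> F Q' = 1 ->
  lift b Q = lift b' Q' -> b = b' /\ Q = Q'.
Proof.
move=> Q0 F1 F1' e; suff eb : b = b'.
  by split=> //; rewrite -(liftK b Q) e -eb liftK.
have endE c P x : F (rcons P x) = 1 -> c * F P * x.1 * frobH S x.2 = c.
  rewrite -cats1 frobenius_cat frobenius_cons frobenius_nil mulg1 -!mulgA => ->.
  by rewrite mulg1.
case/lastP: Q Q0 F1 e => // Q x _ /endE F1; case/lastP: Q' F1' => [|Q' x'].
  by move=> _ /(congr1 size); rewrite size_lift size_rcons.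
move/endE=> F1'; rewrite !lift_rcons => /rcons_inj[_].
by move/(congr1 endpoint); rewrite !endpoint_act F1 F1'.
Qed.

(** Two lifted half-edges compose iff their projections do and the group element between them fixes
    the lifted vertex. By freeness they backtrack iff the projections do and that element is 1. *)
Lemma reduced_step_lift b a h x :
  reduced_step (actH A b (liftH S h))
    (actH A (b * frobH S h * x.1) (liftH S x.2)) =
  gg_reduced_step (XX := XX) (a, h) x.
Proof.
case: x => c k; rewrite /reduced_step /gg_reduced_step /= act_bar.
congr (_ && _).
  rewrite /composable act_root act_bar act_root root_bar_liftH root_lift inE.
  rewrite -actVM (actVM A _ c) (can_eq (actVK _)).
  apply/eqP/andP=> [e'|[/eqP kh /eqP ck]].
    have kh : root k = root (bar h).
      by rewrite -[LHS](projV_lift S) -(projV_act c) e' projV_lift.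
    by split; apply/eqP; [exact: kh|rewrite e'; congr (liftV S _)].
  by rewrite ck; congr (liftV S _).
rewrite bar_liftH -actHM -negb_and; congr negb.
apply/eqP/andP=> [e|[/eqP -> /eqP ->]]; last by rewrite mulg1.
have kh : k = bar h.
  by rewrite -[LHS](projH_act_lift (b * frobH S h * c)) e projH_act_lift.
move: e; rewrite kh => /actH_inj_elt; rewrite -[RHS]mulg1 => /mulgI ->.
by rewrite !eqxx.
Qed.

Lemma path_lift b a h Q :
  path (@reduced_step Y) (actH A b (liftH S h)) (lift (b * frobH S h) Q) =
  path (gg_reduced_step (XX := XX)) (a, h) Q.
Proof.
elim: Q b a h => //= -[c k] Q IH b a h.
by rewrite (reduced_step_lift b a h (c, k)) (IH _ c).
Qed.

(** F(Q) = 1 brings the lift back to base [b], so that the wrap-around steps upstairs and downstairs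
    correspond as well. *)
Lemma cycle_lift b Q : F Q = 1 ->
  path.cycle (@reduced_step Y) (lift b Q) =
  path.cycle (gg_reduced_step (XX := XX)) Q.
Proof.
case: Q => // -[a h] Q; rewrite frobenius_cons /= => F1.
rewrite -(path_lift (b * a)) lift_rcons /=.
have -> : b * a * frobH S h * F Q = b by rewrite -[RHS]mulg1 -F1 !mulgA.
by [].
Qed.

Lemma frobenius_shift Q k : F (shift k Q) = 1 <-> F Q = 1.
Proof.
elim: k => //= k <-; case: (shift k Q) => [|x P]; first by rewrite rot_oversize.
rewrite rot1_cons -cats1 frobenius_cat !frobenius_cons frobenius_nil mulg1.
have mulg_eq1C u v : u * v = 1 -> v * u = 1 :> gT.
  by move/eqP; rewrite -eq_invg_mul => /eqP <-; rewrite mulVg.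
by split=> /mulg_eq1C.
Qed.

Lemma shift_lift b Q k : F Q = 1 ->
  exists b', shift k (lift b Q) = lift b' (shift k Q).
Proof.
move=> F1; elim: k => [|k [b' IH]]; first by exists b.
rewrite /= -!/(shift k _) IH; have /(frobenius_shift Q k) := F1.
case: (shift k Q) => [|x P]; first by exists b'.
rewrite frobenius_cons => F1'; exists (b' * x.1 * frobH S x.2).
rewrite /= !rot1_cons lift_rcons.
have -> // : b' * x.1 * frobH S x.2 * F P = b' by rewrite -[RHS]mulg1 -F1' !mulgA.
Qed.

(** The lift runs through [Q] repeatedly, after j rounds from base b F(Q)^j. Hence bases in the same
    orbit of right multiplication by F(Q) give the same prime. *)
Lemma shift_size_lift b Q j k : F Q ^+ k = 1 ->
  shift (j * size Q) (lift b (power Q k)) = lift (b * F Q ^+ j) (power Q k).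
Proof.
move=> Fk; elim: j => [|j IH]; first by rewrite mulg1.
rewrite mulSn shiftD IH expgSr mulgA; move: (b * _) => c.
case: k Fk {IH} => [|k] Fk; first by elim: (size Q) => //= n ->.
rewrite powerS lift_cat shift_rot ?size_cat ?size_lift ?leq_addr //.
rewrite -[size Q](size_lift c) rot_size_cat -powerS powerSr lift_cat.
by rewrite frobenius_power -mulgA -expgS Fk mulg1.
Qed.

(** The product telescopes. Taking the last endpoint for [b] makes it trivial. *)
Lemma frobenius_descend b p y :
  F (descend b (rcons p y)) = b^-1 * endpoint y.
Proof.
elim: p b => [|z p IH] b /=; rewrite frobenius_cons /=.
  by rewrite frobenius_nil mulg1 mulgA.
  by rewrite IH -[_ * coset_elt z * _]mulgA -/(endpoint z) mulgA mulgK.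
Qed.

End Lifting.

(** * Words up to cyclic shift *)

Section CyclicClasses.
Variables (T : choiceType) (P : pred (seq T)).

Definition class_of s (Ps : P s) : cyclic_class P :=
  \pi_(cyclic_class P) (exist (fun t => is_true (P t)) s Ps).

Lemma class_of_eqP s t (Ps : P s) (Pt : P t) :
  class_of Ps = class_of Pt <-> exists k, t = shift k s.
Proof.
split=> [/eqmodP/asboolP/shiftP //|/shiftP st].
by apply/eqmodP/asboolP.
Qed.

Lemma representativeP (c : cyclic_class P) : P (representative c).
Proof. exact: valP (repr c). Qed.

Lemma class_of_representative (c : cyclic_class P) :
  class_of (representativeP c) = c.
Proof. by rewrite -[RHS]reprK; congr (\pi _); apply: val_inj. Qed.

Lemma representative_class_of s (Ps : P s) :
  exists k, representative (class_of Ps) = shift k s.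
Proof.
by apply/(class_of_eqP Ps (representativeP _)); rewrite class_of_representative.
Qed.

End CyclicClasses.

(** * Primes above a prime of the quotient *)

Section PrimesAbove.
Variables (gT : finGroupType) (Y : graph) (A : graph_action gT Y).
Variable S : quotient_choices A.
Hypothesis freeA : edge_free A.
Local Notation F := (frobenius S).
Local Notation XX := (quotient_gg S).
Local Notation G := [set: gT]%G.
Implicit Types (Q : seq (gT * halfedge (quotient_graph A))) (q : gg_prime XX).
Implicit Types (i : 'I_#|G|).
Local Open Scope group_scope.

Lemma order_frobenius_shift Q k : #[F (shift k Q)] = #[F Q].
Proof.
have expE m : (F (shift k Q) ^+ m == 1) = (F Q ^+ m == 1).
  rewrite -!frobenius_power -shift_power.
  by apply/eqP/eqP=> /(frobenius_shift S (power Q m) k).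
by apply/eqP; rewrite eqn_dvd !order_dvdn expE -[X in _ && X]expE !expg_order eqxx.
Qed.

(** Let f be the order of F(Q). If the lift is s^k, then s descends to a word w with F(w) = 1 and
    w^k = Q^f. Aperiodicity of Q gives w = Q^j with jk = f, and F(Q)^j = 1 forces f to divide j, so
    k = 1. *)
Lemma lift_primitive b Q : @gg_primitive_path _ XX Q ->
  primitive_path (lift S b (power Q #[F Q])).
Proof.
move=> /gg_primitive_pathP[Q0 cQ Qap]; have m0 := order_gt0 (F Q).
have F1 : F (power Q #[F Q]) = 1 by rewrite frobenius_power expg_order.
have Qm0 : power Q #[F Q] != [::] by rewrite power_eq0.
have L0 : lift S b (power Q #[F Q]) != [::].
  by rewrite -size_eq0 size_lift size_eq0.
apply/primitive_pathP; split=> //.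
  by rewrite cycle_lift // cycle_power.
move=> s k sE; have k0 : 0 < k by case: k sE L0 => // ->.
pose w := descend S b s.
have Fw : F w = 1.
  case/lastP: s @w sE => [|s y] /= sE; first exact: frobenius_nil.
  (* [s] ends in the same half-edge as the whole lift, and by [frobenius_descend] only that
     half-edge counts. *)
  rewrite frobenius_descend.
  rewrite -(@frobenius_descend _ _ _ _ b (power (rcons s y) k.-1 ++ s)).
  by rewrite rcons_cat -powerSr prednK // -sE liftK.
have wE : power Q #[F Q] = power w k.
  by rewrite -[LHS](liftK S freeA b) sE -[s](descendK S b) -lift_power // liftK.
have [j wQ] := power_eq_aperiodic Qap m0 k0 wE.
have jk : #[F Q] = (j * k)%N by apply: (power_inj Q0); rewrite wE wQ powerM.
have /dvdn_leq mj : #[F Q] %| j by rewrite order_dvdn -frobenius_power -wQ Fw.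
have j0 : 0 < j by move: m0; rewrite jk muln_gt0 => /andP[].
apply/eqP; rewrite eqn_leq k0 andbT -(leq_pmul2l j0) muln1 -jk; exact: mj.
Qed.

(** Bases are numbered like the rows of [regular_repr], so that [frobenius_rmul] below is the
    permutation underlying its matrix at F(Q). *)
Definition prime_above q i : prime_path Y :=
  class_of (lift_primitive (enum_val i) (representativeP q)).

Definition frobenius_rmul q i : 'I_#|G| :=
  gring_index G (enum_val i * F (representative q)).
Local Notation sigma := frobenius_rmul.

Lemma enum_val_iter q i k :
  enum_val (iter k (sigma q) i) = enum_val i * F (representative q) ^+ k.
Proof.
elim: k => [|k IH] /=; first by rewrite mulg1.
by rewrite gring_indexK ?inE // IH expgSr mulgA.
Qed.

Lemma frobenius_rmul_inj q : injective (sigma q).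
Proof.
move=> i j /(congr1 enum_val); rewrite !(enum_val_iter q _ 1).
by move/mulIg/enum_val_inj.
Qed.

(** Translations of a group are free, so every orbit has as many elements as the cyclic group
    generated by F(Q). *)
Lemma order_frobenius_rmul q i :
  fingraph.order (sigma q) i = #[F (representative q)].
Proof.
set x := F _; have iterE k : (iter k (sigma q) i == i) = (#[x] %| k).
  rewrite order_dvdn -(inj_eq enum_val_inj) enum_val_iter.
  by rewrite -[X in _ == X]mulg1 (inj_eq (mulgI _)).
apply/eqP; rewrite eqn_leq; apply/andP; split; last first.
  rewrite dvdn_leq ?fingraph.order_gt0 // -iterE iter_order //.
  exact: frobenius_rmul_inj.
rewrite leqNgt; apply/negP=> /findex_iter.
have /eqP -> : iter #[x] (sigma q) i == i by rewrite iterE.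
by rewrite findex0 => /eqP; rewrite eq_sym -leqn0 leqNgt order_gt0.
Qed.

Lemma size_prime_above q i :
  size (representative (prime_above q i)) =
  (#[F (representative q)] * size (representative q))%N.
Proof.
have [k ->] :=
  representative_class_of (lift_primitive (enum_val i) (representativeP q)).
by rewrite size_shift size_lift size_power.
Qed.

Lemma prime_above_iter q i k : prime_above q (iter k (sigma q) i) = prime_above q i.
Proof.
apply/esym/class_of_eqP; exists (k * size (representative q))%N => /=.
by rewrite shift_size_lift ?expg_order // enum_val_iter.
Qed.

(** A shift of a closed lift is the lift of the shifted word, so [lift_inj] equates powers of Q' and
    of a shift of Q. Both being aperiodic, they are equal and q = q'. *)
Lemma prime_above_inj q q' i i' : prime_above q i = prime_above q' i' ->
  q = q' /\ fconnect (sigma q) i i'.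
Proof.
move=> /class_of_eqP[k /=].
have [Q0 cQ Qap] := (gg_primitive_pathP _).1 (representativeP q).
have [Q0' cQ' Qap'] := (gg_primitive_pathP _).1 (representativeP q').
have F1 q1 : F (power (representative q1) #[F (representative q1)]) = 1.
  by rewrite frobenius_power expg_order.
have [b bE] := shift_lift (enum_val i) k (F1 q).
rewrite bE shift_power => e.
have [|||_ QE] := lift_inj freeA _ _ _ e; rewrite ?power_eq0 ?order_gt0 //.
  by rewrite -shift_power; apply/frobenius_shift.
have [j jE] := power_eq_aperiodic Qap' (order_gt0 _) (order_gt0 _) QE.
have sap := aperiodic_shift (k := k) Qap.
have sQ : shift k (representative q) = representative q'.
  by rewrite jE (sap _ _ jE) power1.
have qq : q = q'.
  rewrite -(class_of_representative q) -(class_of_representative q').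
  by apply/class_of_eqP; exists k.
subst q'; split=> //; move: e.
(* Now Q is fixed by the shift, which therefore consists of whole periods and multiplies the base by
   a power of F(Q). *)
have /dvdnP[l kE] := aperiodic_shift_id Qap sQ.
rewrite -shift_power -bE kE shift_size_lift ?expg_order //.
case/(lift_inj freeA); rewrite ?power_eq0 ?order_gt0 //.
rewrite -enum_val_iter => /enum_val_inj -> _.
exact: fconnect_iter.
Qed.

(** Descend from the base that makes F trivial and let Q be the aperiodic root of the result Q^m.
    The order f of F(Q) divides m, so the path is a power of the lift of Q^f; being primitive, it
    equals this lift. *)
Lemma prime_above_surj (p : prime_path Y) : exists q i, prime_above q i = p.
Proof.
have [p0 cp pap] := (primitive_pathP _).1 (representativeP p).
have [b F1] : exists b, F (descend S b (representative p)) = 1.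
  case/lastP: (representative p) p0 => // s y _; exists (endpoint S y).
  by rewrite frobenius_descend mulVg.
have w0 : descend S b (representative p) != [::].
  by rewrite -size_eq0 -(size_lift S b) descendK size_eq0.
have [Q [m [Qap m0 wE]]] := aperiodic_root w0.
have cQ : path.cycle (gg_reduced_step (XX := XX)) Q.
  by rewrite -(cycle_power _ Q m0) -wE -(cycle_lift freeA b F1) descendK.
have Qprim : @gg_primitive_path _ XX Q.
  by apply/gg_primitive_pathP; split=> //; apply: aperiodic_neq0.
have /dvdnP[e mE] : #[F Q] %| m by rewrite order_dvdn -frobenius_power -wE F1.
have pE : representative p = lift S b (power Q #[F Q]).
  have : representative p = power (lift S b (power Q #[F Q])) e.
    rewrite -lift_power ?frobenius_power ?expg_order // -powerM mulnC -mE -wE.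
    by rewrite descendK.
  by move=> e1; rewrite {1}e1 (pap _ _ e1) power1.
pose q : gg_prime XX := class_of Qprim.
(* The chosen representative of [q] is only a shift of [Q], which changes the base to [b']. *)
have [k kE] := representative_class_of Qprim; rewrite -/q /= in kE.
have [b' bE] : exists b', shift k (lift S b (power Q #[F Q])) =
    lift S b' (shift k (power Q #[F Q])).
  by apply: shift_lift; rewrite frobenius_power expg_order.
exists q, (gring_index G b'); rewrite -[RHS]class_of_representative.
apply/esym/class_of_eqP; exists k => /=.
rewrite gring_indexK ?inE // pE bE shift_power kE; congr (lift _ _ (power _ _)).
by rewrite order_frobenius_shift.
Qed.

End PrimesAbove.

Local Open Scope ring_scope.

(** * Determinants of permutation matrices *)

Section Determinants.
Variable R : comNzRingType.

(** A permutation with a nonzero term never lowers the rank and raises it at every moved point; as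
    it preserves the sum of all ranks, it is the identity. The rank need not be injective. *)
Lemma det_graded n (rk : 'I_n -> nat) (M : 'M[R]_n) :
    (forall i j, M i j != 0 -> i != j -> (rk i < rk j)%N) ->
  \det M = \prod_i M i i.
Proof.
move=> upM; rewrite /determinant (bigD1 1%g) //= odd_perm1 mul1r.
rewrite [X in _ + X]big1 ?addr0 => [|s s1].
  by apply: eq_bigr => i _; rewrite perm1.
have [/existsP[i /eqP Mi0]|/existsPn nz] := boolP [exists i, M i (s i) == 0].
  by rewrite (bigD1 i) //= Mi0 mul0r mulr0.
have le_s i : (rk i <= rk (s i))%N.
  have [e|ne] := eqVneq i (s i); first by rewrite -e.
  exact/ltnW/upM.
have sum_s : (\sum_i rk i = \sum_i rk (s i))%N.
  exact: (reindex_inj (@perm_inj _ s)).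
have [_] := leqif_sum (P := xpredT) (fun i _ => leqif_eq (le_s i)).
rewrite -sum_s eqxx => /esym/forall_inP rk_s; case/eqP: s1; apply/permP=> i.
rewrite perm1; apply/eqP; rewrite eq_sym; apply/negP=> /negP ne.
by have := upM _ _ (nz i) ne; rewrite (eqP (rk_s i isT)) ltnn.
Qed.

Section Cycles.
Variables (n : nat) (f : 'I_n -> 'I_n).
Hypothesis f_inj : injective f.

Let pos i := findex f (froot f i) i.

Lemma fconnect_froot i : fconnect f (froot f i) i.
Proof. by rewrite fconnect_sym ?connect_root. Qed.

Lemma froot_step i : froot f (f i) = froot f i.
Proof. by apply/esym/fingraph.rootP; [exact: fconnect_sym|exact: fconnect1]. Qed.

Lemma findex_froot_step i : f i != froot f i -> pos (f i) = (pos i).+1.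
Proof.
rewrite /pos froot_step => fi; have ci := fconnect_froot i.
have fiE : f i = iter (findex f (froot f i) i).+1 f (froot f i).
  by rewrite iterS iter_findex.
rewrite [in LHS]fiE findex_iter // ltn_neqAle findex_max // andbT.
by apply: contraNneq fi => e; rewrite fiE e iter_order.
Qed.

Lemma order_froot i : f i = froot f i -> fingraph.order f (froot f i) = (pos i).+1.
Proof.
move=> fi; have ci := fconnect_froot i; have := findex_max ci.
rewrite -/(pos i) leq_eqVlt => /predU1P[//|/findex_iter].
by rewrite iterS iter_findex // fi findex0.
Qed.

(* 1 - cP factors as (1 - cN) W, both triangular for a suitable ranking: N steps
   along an orbit without ever returning to its representative, W jumps from any
   point directly to the representative. *)
Lemma det_permutation_cycles (c : R) :
  \det (1%:M - c *: \matrix_(i, j) (f i == j)%:R) =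
  \prod_(i | froots f i) (1 - c ^+ fingraph.order f i).
Proof.
pose N : 'M[R]_n := \matrix_(i, j) ((f i != froot f i) && (f i == j))%:R.
(* The number of steps from [i] to the next visit of its representative, a full turn if [i] is that
   representative. *)
pose e i := (fingraph.order f (froot f i) - pos i)%N.
pose W : 'M[R]_n := \matrix_(i, j) ((i == j)%:R - c ^+ e i * (froot f i == j)%:R).
have -> : 1%:M - c *: \matrix_(i, j) (f i == j)%:R = (1%:M - c *: N) *m W.
  apply/matrixP=> i j; rewrite mulmxBl mul1mx -scalemxAl !mxE.
  rewrite (bigD1 (f i)) //= big1 ?addr0 => [|k ki]; last first.
    by rewrite mxE (eq_sym _ k) (negPf ki) andbF mul0r.
  rewrite !mxE eqxx andbT froot_step.
  have [fi|fi] := eqVneq (f i) (froot f i).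
    by rewrite mul0r mulr0 subr0 /e order_froot // subSnn expr1 fi.
  have -> : e i = (e (f i)).+1.
    rewrite /e findex_froot_step // froot_step subnSK //.
    exact: findex_max (fconnect_froot i).
  by rewrite exprS mul1r; ring.
rewrite det_mulmx (det_graded (rk := pos)) => [|i j]; last first.
  rewrite !mxE => nz ij; move: nz; rewrite (negPf ij) sub0r.
  have [fi|fi] := eqVneq (f i) (froot f i); first by rewrite mulr0 oppr0 eqxx.
  have [<- _|_] := eqVneq (f i) j; first by rewrite findex_froot_step.
  by rewrite mulr0 oppr0 eqxx.
rewrite big1 ?mul1r => [|i _]; last first.
  rewrite !mxE eqxx; have [fi|fi] := eqVneq (f i) (froot f i).
    by rewrite mulr0 subr0.
  have [fii|_] := eqVneq (f i) i; last by rewrite mulr0 subr0.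
  by have := findex_froot_step fi; rewrite fii => /n_Sn.
(* Rank 1 for representatives and 0 for other points suffices for W, whose off-diagonal entries all
   lead to a representative. *)
rewrite (det_graded (rk := fun i => froots f i)) => [|i j]; last first.
  rewrite !mxE => nz ij; move: nz; rewrite (negPf ij) sub0r.
  have [ri _|_] := eqVneq (froot f i) j; last by rewrite mulr0 oppr0 eqxx.
  by rewrite /roots -ri (root_root (fconnect_sym f_inj)) eqxx ri eq_sym (negPf ij).
rewrite [RHS]big_mkcond; apply: eq_bigr => i _; rewrite mxE eqxx.
rewrite /roots; case: (eqVneq (froot f i) i) => [ri|_].
  by rewrite mulr1 /e /pos ri findex0 subn0.
by rewrite mulr0 subr0.
Qed.

End Cycles.
End Determinants.

Lemma regular_mxE (R : fieldType) (gT : finGroupType) x :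
  regular_repr R [set: gT]%G x =
  \matrix_(i, j) (gring_index [set: gT]%G (enum_val i * x)%g == j)%:R.
Proof. by apply/matrixP=> i j; rewrite !mxE eqxx eq_sym. Qed.

(** * Unordered products *)

Section ProductEstimates.
Variables (C : numDomainType) (I : Type).
Implicit Types (f : I -> C) (x : I -> C) (s : seq I).

Lemma norm_prod_le s f x : (forall i, `|f i - 1| <= x i) ->
  `|\prod_(i <- s) f i| <= \prod_(i <- s) (1 + x i).
Proof.
move=> fx; rewrite normr_prod; apply: ler_prod => i _; rewrite normr_ge0 /=.
by rewrite -[f i](subrK 1) addrC (le_trans (ler_normD _ _)) // normr1 lerD2l.
Qed.

(** Adding one factor changes both sides by the same recursion, an equality for the majorant. *)
Lemma norm_prod_sub1_le s f x : (forall i, `|f i - 1| <= x i) ->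
  `|\prod_(i <- s) f i - 1| <= \prod_(i <- s) (1 + x i) - 1.
Proof.
move=> fx; have x0 i : 0 <= x i by apply: le_trans (fx i).
elim: s => [|i s IH]; first by rewrite !big_nil !subrr normr0.
rewrite !big_cons; set p := \prod_(j <- s) f j; set b := \prod_(j <- s) _.
have -> : f i * p - 1 = (f i - 1) * p + (p - 1) by ring.
have -> : (1 + x i) * b - 1 = x i * b + (b - 1) by ring.
rewrite (le_trans (ler_normD _ _)) // lerD // normrM.
by rewrite ler_pM // norm_prod_le.
Qed.

End ProductEstimates.

Section ComplexNorm.
Variable R : realType.

Lemma normc_ge_Im (w : R[i]) : `|complex.Im w|%:C%C <= `|w|.
Proof. by rewrite normc_def lecR -sqrtr_sqr ler_wsqrtr // lerDr sqr_ge0. Qed.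

Lemma norm_le_Re_Im (w : R[i]) :
  `|w| <= (`|complex.Re w| + `|complex.Im w|)%:C%C.
Proof.
rewrite {1}[w]complexE (le_trans (ler_normD _ _)) // normrM !normc_def /=.
rewrite expr0n expr1n.
rewrite !addr0 add0r sqrtr1 mul1r !sqrtr_sqr.
by rewrite rmorphD.
Qed.

End ComplexNorm.

Section ComplexCauchy.
Variables (R : realType) (T : Type) (F : set_system T).
Context {FF : ProperFilter F}.
Local Open Scope classical_set_scope.

(** Real and imaginary parts do not increase distances, so each converges by completeness of the
    reals. *)
Lemma complex_cauchy_cvg (z : T -> Cplx R) :
    (forall e : R, 0 < e -> exists w, \forall t \near F, `|w - z t| <= e%:C%C) ->
  cvg (z @ F).
Proof.
move=> zF.
have real_cvg (p : Cplx R -> R) : (forall w w', p (w - w') = p w - p w') ->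
    (forall w, (`|p w|%:C)%C <= `|w|) -> exists l : R, p \o z @ F --> l.
  move=> pB p_le; apply/cvg_ex.
  apply: (@cauchy_cvg R); apply: cauchy_exP => e e0.
  (* Halving turns the non-strict bound into the strict one of a ball. *)
  have [|w zw] := zF (e / 2); first by rewrite divr_gt0.
  exists (p w); apply: filterS zw => t; rewrite /ball /= -pB -ltcR => zt.
  by rewrite (le_lt_trans (le_trans (p_le _) zt)) // ltcR; lra.
have [|w|a ReF] := real_cvg (@complex.Re R); first by move=> [? ?] [? ?].
  exact: normc_ge_Re.
have [|w|b ImF] := real_cvg (@complex.Im R); first by move=> [? ?] [? ?].
  exact: normc_ge_Im.
apply/cvg_ex; exists ((a +i* b)%C : Cplx R); apply/cvgrPdist_le => e e0.
(* The tolerance is an element of [Cplx R]; being positive, it is real. *)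
have eE : e = (complex.Re e)%:C%C by rewrite RRe_real // gtr0_real.
have e2 : 0 < complex.Re e / 2 by rewrite divr_gt0 // -ltcR -eE.
move/cvgrPdist_le: ReF => /(_ _ e2) ReF; move/cvgrPdist_le: ImF => /(_ _ e2) ImF.
apply: filterS2 ReF ImF => t /= Ret Imt.
rewrite (le_trans (norm_le_Re_Im _)) // eE lecR.
by move: Ret Imt; case: (z t) => c d /=; lra.
Qed.

End ComplexCauchy.

Section UnorderedProducts.
Local Open Scope classical_set_scope.
Local Open Scope fset_scope.

Lemma partial_prodE (C : numClosedFieldType) (I : choiceType) (f : I -> C) J :
  partial_prod f J = \prod_(i <- J) f i.
Proof. by rewrite big_seq_fsetE. Qed.

(** Write P and B for the partial products of f and of 1 + x. For J containing J0, |P(J0) - P(J)| is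
    at most B(J0) (B(J \ J0) - 1) = B(J) - B(J0), which is small when B(J0) is close to the supremum
    of B. *)
Lemma cvg_prod_bounded (R : realType) (I : choiceType) (f : I -> Cplx R)
    (x : I -> R) (M : R) :
    (forall i, `|f i - 1| <= (x i)%:C%C) ->
    (forall J : {fset I}, \prod_(i <- J) (1 + x i) <= M) ->
  cvg_prod f.
Proof.
move=> fx xM; pose B (J : {fset I}) := \prod_(i <- J) (1 + x i).
have Bsplit J0 J : J0 `<=` J -> forall (K : comPzRingType) (F : I -> K),
    \prod_(i <- J) F i = \prod_(i <- J0) F i * \prod_(i <- J `\` J0) F i.
  move=> sub K F; rewrite (big_fsetID _ (mem J0)) /=; congr (_ * _).
    apply: eq_fbigl => i; rewrite !inE /=; apply: andb_idl.
    exact: (fsubsetP sub).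
  by apply: eq_fbigl => i; rewrite !inE /= andbC.
pose E := [set B J | J in setT]%classic.
have supE : has_sup E.
  split; first by exists (B fset0), fset0.
  by exists M => _ [J _ <-]; exact: xM.
apply: (complex_cauchy_cvg (FF := totally_filter)) => e e0.
have [_ [J0 _ <-] J0e] := sup_adherent e0 supE.
exists (partial_prod f J0); exists J0 => // J /= sub.
rewrite !partial_prodE (Bsplit J0 J) // -[X in X - _]mulr1 -mulrBr normrM distrC.
have xC i : `|f i - 1| <= (x i)%:C%C by exact: fx.
have BC s : \prod_(i <- s) (1 + (x i)%:C%C) =
    (\prod_(i <- s) (1 + x i))%:C%C :> R[i].
  by rewrite rmorph_prod; apply: eq_bigr => i _; rewrite rmorphD rmorph1.
have le1 := norm_prod_le J0 xC; have le2 := norm_prod_sub1_le (J `\` J0) xC.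
rewrite (le_trans (ler_pM _ _ le1 le2)) //.
rewrite !BC -(rmorph1 (real_complex R)) -rmorphB -rmorphM lecR.
rewrite mulrBr mulr1 -(Bsplit J0 J sub R) lerBlDl.
have : B J <= sup E by apply: sup_upper_bound => //; exists J.
by rewrite -/(B J) -/(B J0); lra.
Qed.

(** A partial product of [g] is one of [f] over a union of disjoint finite fibres, and such unions
    eventually contain any given finite set. *)
Lemma unordered_prod_fibers (C : numClosedFieldType) (I K : choiceType)
    (f : I -> C) (g : K -> C) (fib : K -> {fset I}) :
    (forall i, exists k, i \in fib k) ->
    (forall i k k', i \in fib k -> i \in fib k' -> k = k') ->
    (forall k, g k = \prod_(i <- fib k) f i) ->
    cvg_prod f -> cvg_prod g /\ unordered_prod f = unordered_prod g.
Proof.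
move=> fib_ex fib_inj gE f_cvg.
pose U (J : {fset K}) := \bigcup_(k <- J) fib k.
have partE J : partial_prod g J = partial_prod f (U J).
  rewrite !partial_prodE partition_disjoint_bigfcup => [|k k' _ _ kk'].
    by apply: eq_bigr => k _; exact: gE.
  apply/fdisjointP => i ik; apply: contra_neqN kk' => ik'.
  exact: fib_inj ik ik'.
have U_tot : U @ totally `=>` totally.
  move=> A [I0 _ I0A]; have [k kP] := choice fib_ex.
  exists [fset k i | i in I0] => // J /= sub; apply: I0A => /=.
  apply/fsubsetP=> i i0; apply/bigfcupP; exists (k i); last exact: kP.
  by rewrite andbT; apply: (fsubsetP sub); apply: in_imfset.
have gl : partial_prod g @ totally --> unordered_prod f.
  have -> : partial_prod g = partial_prod f \o U by apply/funext.
  exact: cvg_comp U_tot f_cvg.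
split; first by apply/cvg_ex; eexists; exact: gl.
apply/esym; by apply: cvg_lim gl; [exact: norm_hausdorff|exact: totally_filter].
Qed.

End UnorderedProducts.

(** * Convergence of the zeta function *)

Section Counting.
Variables (R : realFieldType) (T : finType).

Lemma count_size_le (s : seq (seq T)) n : uniq s ->
  (count (fun w => size w == n) s <= #|T| ^ n)%N.
Proof.
move=> us; rewrite -size_filter -card_tuple cardE -(size_map val).
apply: uniq_leq_size; first exact: filter_uniq.
move=> w; rewrite mem_filter => /andP[wn _]; apply/mapP.
by exists (Tuple wn); rewrite ?mem_enum.
Qed.

(** Grouped by length n >= 1, the words contribute at most (|T| t)^n <= 5^-n, and these bounds add
    up to at most 1/4. *)
Lemma sum_words_le (t : R) (s : seq (seq T)) : 0 <= t -> #|T|%:R * t <= 5^-1 ->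
  uniq s -> [::] \notin s -> \sum_(w <- s) t ^+ size w <= 4^-1.
Proof.
move=> t0 Tt us s0; pose N := \max_(w <- s) size w.
have fold_size w : w \in s -> t ^+ size w =
    \sum_(n < N) (if size w == n.+1 then t ^+ n.+1 else 0).
  move=> ws; have w0 : (0 < size w)%N.
    by rewrite lt0n size_eq0; apply: contraNneq s0 => <-.
  have lt_w : ((size w).-1 < N)%N by rewrite prednK //; exact: leq_bigmax_seq.
  rewrite -big_mkcond (bigD1 (Ordinal lt_w)) /= prednK ?eqxx //.
  rewrite big1 ?addr0 // => n /andP[/eqP wn]; rewrite -val_eqE /= wn /=.
  by rewrite eqxx.
rewrite big_seq (eq_bigr _ fold_size) -big_seq exchange_big /=.
have inner (n : 'I_N) : true ->
    \sum_(w <- s) (if size w == n.+1 then t ^+ n.+1 else 0) <= 5^-1 ^+ n.+1.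
  move=> _; rewrite -big_mkcond big_const_seq iter_addr_0 -[leLHS]mulr_natl.
  apply: (@le_trans _ _ ((#|T|%:R * t) ^+ n.+1)); last first.
    by rewrite lerXn2r // nnegrE ?invr_ge0 // mulr_ge0.
  by rewrite exprMn -natrX ler_wpM2r ?exprn_ge0 // ler_nat count_size_le.
apply: le_trans (ler_sum _ inner) _.
have -> : \sum_(n < N) 5^-1 ^+ n.+1 = (1 - 5^-1 ^+ N) / 4 :> R.
  elim: (N) => [|M IH]; first by rewrite big_ord0 subrr mul0r.
  by rewrite big_ord_recr /= IH exprS; field.
by rewrite -[leRHS]mul1r ler_pM2r ?invr_gt0 // gerBl exprn_ge0 ?invr_ge0.
Qed.

(** Induction, from (1 + x)(1 - x - S) <= 1 - S for nonnegative x and S. *)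
Lemma prod1D_bound (I : Type) (s : seq I) (x : I -> R) : (forall i, 0 <= x i) ->
  \prod_(i <- s) (1 + x i) * (1 - \sum_(i <- s) x i) <= 1.
Proof.
move=> x0; elim: s => [|i s]; first by rewrite !big_nil subr0 mulr1.
apply: le_trans; rewrite !big_cons.
have S0 : 0 <= \sum_(j <- s) x j by apply: sumr_ge0.
have P0 : 0 <= \prod_(j <- s) (1 + x j) by apply: prodr_ge0 => j _; rewrite addr_ge0.
rewrite mulrAC mulrC ler_wpM2l //; have := x0 i; nra.
Qed.

End Counting.

Lemma norm_inv1B_sub1_le (C : numFieldType) (v : C) :
  `|v| <= 2^-1 -> `|(1 - v)^-1 - 1| <= 2 * `|v|.
Proof.
move=> v2; have d2 : 2^-1 <= `|1 - v|.
  rewrite (le_trans _ (lerB_dist _ _)) // normr1 lerBrDr.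
  by rewrite (le_trans (lerD (lexx _) v2)) // [leLHS](_ : _ = 1) //; field.
have d0 : 0 < `|1 - v| by rewrite (lt_le_trans _ d2) // invr_gt0.
have nz : 1 - v != 0 by rewrite -normr_gt0.
have -> : (1 - v)^-1 - 1 = v / (1 - v) by field.
rewrite normrM normfV mulrC ler_wpM2r // -[2]invrK lef_pV2 ?posrE //.
by rewrite invr_gt0.
Qed.

Section ZetaConvergence.
Variables (R : realType) (Y : graph).

Lemma representative_inj (T : choiceType) (P : pred (seq T)) :
  injective (@representative T P).
Proof. by move=> p q /val_inj/(congr1 \pi_(cyclic_class P)%qT); rewrite !reprK. Qed.

Lemma zeta_factor_cvg (u : Cplx R) :
    `|u| < ((5 * (#|halfedge Y|.+1)%:R)^-1 : R)%:C%C ->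
  cvg_prod (zeta_factor Y u).
Proof.
pose t := complex.Re `|u|; have uE : `|u| = t%:C%C.
  by rewrite RRe_real //; exact: (@normr_real (Cplx R) (Cplx R)).
rewrite uE ltcR => ltt; have t0 : 0 <= t.
  by rewrite -lecR -uE; exact: (@normr_ge0 (Cplx R) (Cplx R)).
have Tt : #|halfedge Y|.+1%:R * t <= 5^-1.
  rewrite mulrC -ler_pdivlMr ?ltr0n // -invfM ltW //.
(* The successor in the radius yields [t <= 5^-1] too, whatever the number of half-edges. *)
have [Tt1 t5] : #|halfedge Y|%:R * t <= 5^-1 /\ t <= 5^-1.
  move: Tt; rewrite -addn1 natrD mulrDl mul1r => Tt.
  have : 0 <= #|halfedge Y|%:R * t by rewrite mulr_ge0.
  by split; lra.
have size0 (p : prime_path Y) : representative p != [::].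
  by have /and3P[/andP[]] := valP (repr p).
(* The factor 2 comes from [norm_inv1B_sub1_le]. These majorants sum to at most 1/2, so by
   [prod1D_bound] the products of 1 + x stay below the bound 2. *)
pose x (p : prime_path Y) := 2 * t ^+ size (representative p).
apply: (@cvg_prod_bounded R _ _ x 2) => [p|J].
  rewrite /zeta_factor /x; set n := size _.
  have vn : `|u ^+ n| = (t ^+ n)%:C%C by rewrite normrX uE rmorphXn.
  have := @norm_inv1B_sub1_le _ (u ^+ n); rewrite vn.
  have -> : (2 * t ^+ n)%:C%C = 2 * (t ^+ n)%:C%C by rewrite rmorphM rmorph_nat.
  apply.
  suff: (t ^+ n)%:C%C <= (2^-1)%:C%C :> R[i] by rewrite fmorphV rmorph_nat.
  rewrite lecR.
  have n0 : (0 < n)%N by rewrite lt0n size_eq0.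
  rewrite -(prednK n0) exprS (le_trans (ler_piMr _ _)) ?exprn_ile1 //; lra.
have xS : \sum_(i <- J) x i <= 2^-1.
  rewrite -mulr_sumr -(big_map (@representative _ _) predT (fun w => t ^+ size w)).
  have := @sum_words_le R (halfedge Y) t [seq representative i | i <- J] t0 Tt1.
  rewrite map_inj_uniq ?fset_uniq; last exact: representative_inj.
  move=> /(_ isT) W.
  have: \sum_(w <- [seq representative i | i <- J]) t ^+ size w <= 4^-1.
    by apply: W; apply/mapP=> -[p _ /esym/eqP]; apply/negP.
  lra.
have x0 p : 0 <= x p by rewrite mulr_ge0 ?exprn_ge0.
have P0 : 0 <= \prod_(i <- J) (1 + x i).
  by apply: prodr_ge0 => p _; rewrite addr_ge0.
have := prod1D_bound J x0; move: P0 xS.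
move: (\prod_(i <- J) (1 + x i)) (\sum_(i <- J) x i) => P S; nra.
Qed.

End ZetaConvergence.

(** * Factors of the L-function as products of zeta factors *)

Section Factorization.
Variables (gT : finGroupType) (Y : graph) (A : graph_action gT Y).
Variable S : quotient_choices A.
Hypothesis freeA : edge_free A.

(** Only one base is kept per orbit, so that each prime is listed once. *)
Definition primes_above (q : gg_prime (quotient_gg S)) : {fset prime_path Y} :=
  [fset prime_above freeA q i | i in
    [pred i : 'I_#|[set: gT]%G| | froots (frobenius_rmul q) i]]%fset.

Lemma primes_aboveP q p :
  reflect (exists2 i, froots (frobenius_rmul q) i & p = prime_above freeA q i)
          (p \in primes_above q).
Proof. by apply: (iffP (imfsetP _ _ _ _)). Qed.

(** With c = u^|Q|, an orbit of length f contributes 1 - c^f, and f |Q| is the length of the prime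
    above it. *)
Lemma L_factor_primes_above (C : fieldType) (u : C) q :
  L_factor S (right_regular_repr C gT) u q =
  \prod_(p <- primes_above q) zeta_factor Y u p.
Proof.
rewrite /L_factor /L_term /right_regular_repr regular_mxE.
rewrite (det_permutation_cycles (@frobenius_rmul_inj _ _ _ _ q)).
rewrite big_imfset /= => [|i j]; last first.
  rewrite !inE => /eqP ri /eqP rj /prime_above_inj[_].
  move/(fingraph.rootP (fconnect_sym (@frobenius_rmul_inj _ _ _ _ q))).
  by rewrite ri rj.
rewrite prodfV big_enum /=; congr _^-1; apply: eq_bigr => i _.
by rewrite size_prime_above order_frobenius_rmul mulnC exprM.
Qed.

Lemma primes_above_cover p : exists q, p \in primes_above q.
Proof.
have [q [i <-]] := prime_above_surj S freeA p; exists q; apply/primes_aboveP.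
have inj := @frobenius_rmul_inj _ _ _ _ q.
exists (froot (frobenius_rmul q) i).
  exact: roots_root (fconnect_sym inj) _.
by rewrite -(iter_findex (connect_root _ i)) prime_above_iter.
Qed.

End Factorization.

Theorem proposition4p14 (R : realType) (gT : finGroupType) (Y : graph)
    (A : graph_action gT Y) (S : quotient_choices A) :
  connected_graph Y -> edge_free A ->
  exists2 e : R, 0 < e &
    forall u : Cplx R, `|u| < (e%:C)%C ->
      [/\ cvg_prod (zeta_factor Y u),
          cvg_prod (L_factor S (right_regular_repr (Cplx R) gT) u)
        & ihara_zeta Y u = artin_ihara_L S (right_regular_repr (Cplx R) gT) u].
Proof.
move=> _ freeA; exists (5 * (#|halfedge Y|.+1)%:R)^-1.
  by rewrite invr_gt0 mulr_gt0.
move=> u /zeta_factor_cvg cvg_zeta.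
have [] := @unordered_prod_fibers (Cplx R) _ _ (zeta_factor Y u)
  (L_factor S (right_regular_repr (Cplx R) gT) u) (primes_above (S := S) freeA).
- exact: primes_above_cover.
- move=> p q q' /primes_aboveP[i _ ->] /primes_aboveP[j _].
  by case/prime_above_inj.
- exact: L_factor_primes_above.
- exact: cvg_zeta.
by [].
Qed.
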